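(* Let $n, s, r \ge 1$ be integers, let $d = sr$, and let $\sigma > 0$. Let $\mathbf{M} \in \mathbb{R}^{n\times n}$ be a symmetric positive definite matrix, and equip $\mathbb{R}^n$ with the inner product $\langle \mathbf{u}, \mathbf{v}\rangle_{\mathbf{M}} = \mathbf{u}^T \mathbf{M}\mathbf{v}$ and $\mathbb{R}^d$ with the Euclidean inner product. Let $\boldsymbol{\Gamma}_{\mathrm{pr}} \in \mathbb{R}^{n \times n}$ be self-adjoint and positive definite with respect to $\langle\cdot,\cdot\rangle_{\mathbf{M}}$. Let $\mathbf{F} \in \mathbb{R}^{d\times n}$ be an arbitrary matrix and let $\mathbf{F}^* = \mathbf{M}^{-1}\mathbf{F}^T \in \mathbb{R}^{n \times d}$ be its adjoint with respect to these inner products. Let $\mathbf{w} = (w_1,\ldots,w_s) \in [0,1]^s$ and let $\mathbf{W} = \mathbf{I}_r \otimes \mathrm{diag}(w_1,\ldots,w_s) \in \mathbb{R}^{d\times d}$. Then (with all the inverses below existing) $$ \left(\sigma^{-2}\mathbf{F}^* \mathbf{W} \mathbf{F} + \boldsymbol{\Gamma}_{\mathrm{pr}}^{-1}\right)^{-1} = \boldsymbol{\Gamma}_{\mathrm{pr}} - \sigma^{-2}\boldsymbol{\Gamma}_{\mathrm{pr}}\mathbf{F}^*\left(\mathbf{I} + \sigma^{-2}\mathbf{W} \mathbf{F} \boldsymbol{\Gamma}_{\mathrm{pr}}\mathbf{F}^*\right)^{-1}\mathbf{W} \mathbf{F} \boldsymbol{\Gamma}_{\mathrm{pr}}, $$ where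 $\mathbf{I}$ is the $d \times d$ identity matrix.
   Context: The setting is a discretized Bayesian linear inverse problem. The matrix $\mathbf{F}$ is the discretized forward (parameter-to-observable) operator from the parameter space $\mathbb{R}^n$ to the measurement space $\mathbb{R}^d$. The matrix $\mathbf{M}$ is the finite element mass matrix, which defines the mass-weighted inner product on the parameter space. The matrix $\boldsymbol{\Gamma}_{\mathrm{pr}}$ is the discretized prior covariance, the observation noise is Gaussian with covariance $\sigma^2 \mathbf{I}$, and $\mathbf{w}$ is a vector of design weights for $s$ candidate sensors, each measuring at $r$ observation times. Thus $\mathbf{W}$ is block diagonal with $r$ identical diagonal blocks $\mathrm{diag}(w_1,\dots,w_s)$. Self-adjointness of $\boldsymbol{\Gamma}_{\mathrm{pr}}$ with respect to $\langle\cdot,\cdot\rangle_{\mathbf{M}}$ means $\mathbf{M}^{-1}\boldsymbol{\Gamma}_{\mathrm{pr}}^T\mathbf{M} = \boldsymbol{\Gamma}_{\mathrm{pr}}$, and positive definiteness means $\langle \mathbf{u}, \boldsymbol{\Gamma}_{\mathrm{pr}}\mathbf{u}\rangle_{\mathbf{M}} > 0$ for all nonzero $\mathbf{u}\in\mathbb{R}^n$. The left-hand side of the identity is the posterior covariance matrix. *)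

(* Defs.v *)
From mathcomp Require Export all_boot all_order all_algebra.
From mathcomp Require Export reals.
From mathcomp Require Export mxtens.

Set Implicit Arguments.
Unset Strict Implicit.
Unset Printing Implicit Defensive.

Import GRing.Theory Num.Theory.

Local Open Scope ring_scope.

Definition mdot (R : realType) (n : nat) (M : 'M[R]_n) (u v : 'cV[R]_n) : R :=
  (u^T *m M *m v) ord0 ord0.

Definition sym_posdef (R : realType) (n : nat) (M : 'M[R]_n) : Prop :=
  M^T = M /\ forall u : 'cV[R]_n, u != 0 -> 0 < (u^T *m M *m u) ord0 ord0.

(* G equals its adjoint for <.,.>_M, which is invmx M *m G^T *m M; the Gram
   matrix M is meant to be invertible. *)
Definition mselfadjoint (R : realType) (n : nat) (M G : 'M[R]_n) : Prop :=
  invmx M *m G^T *m M = G.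

Definition mposdef (R : realType) (n : nat) (M G : 'M[R]_n) : Prop :=
  forall u : 'cV[R]_n, u != 0 -> 0 < mdot M u (G *m u).

(* Adjoint of F : (R^n, <.,.>_M) -> (R^d, Euclidean). *)
Definition madjoint (R : realType) (n d : nat) (M : 'M[R]_n) (F : 'M[R]_(d, n))
  : 'M[R]_(n, d) := invmx M *m F^T.

(* The row-major index of *t, (k, i) |-> k * s + i, makes this the block
   diagonal matrix with r blocks diag(w). *)
Definition weightmx (R : realType) (r s : nat) (w : 'rV[R]_s) : 'M[R]_(r * s) :=
  (1%:M : 'M[R]_r) *t diag_mx w.

(* Main.v *)
Require Import Defs.

Set Implicit Arguments.
Unset Strict Implicit.
Unset Printing Implicit Defensive.

Import Order.TTheory GRing.Theory Num.Theory.

Local Open Scope ring_scope.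

(** The identity is an instance of the Woodbury formula for the matrix
    [U *m V + invmx G] with [U = sigma ^- 2 *: Fs] and [V = W *m F]
    ([woodbury]).  That formula is pure algebra: as soon as [G] and
    [U *m V + invmx G] are invertible, so is [1%:M + V *m G *m U]
    ([woodbury_capacitance_unitmx]), and the inverse of the former can be
    written with the inverse of the latter.

    What remains is to invert [M], [Gpr] and the posterior precision matrix.
    All three follow from one fact ([mposdef_unitmx]): if <u, A u>_M > 0 for
    every nonzero u, then M *m A has trivial kernel, so that both M and A are
    invertible.  It applies to the prior covariance by hypothesis, which also
    settles M, and to the precision matrix H because
    <u, H u>_M = sigma^-2 (F u)^T W (F u) + <u, Gpr^-1 u>_M,
    where the first summand is nonnegative, W being diagonal with nonnegative
    entries ([weightmx_ge0]), and the second is positive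
    ([mposdef_invmx]). *)

(** Writing [H] for [U *m V + invmx G], the inverse of [1%:M + V *m G *m U] is
    [1%:M - V *m invmx H *m U]. *)
Lemma woodbury_capacitance_unitmx (R : comUnitRingType) (n d : nat)
    (G : 'M[R]_n) (U : 'M[R]_(n, d)) (V : 'M[R]_(d, n)) :
  G \in unitmx -> U *m V + invmx G \in unitmx ->
  1%:M + V *m G *m U \in unitmx.
Proof.
move=> uG; set H := _ + invmx G => uH.
(* G *m H = G *m U *m V + 1, hence G *m (U *m V) *m invmx H = G - invmx H. *)
have GUV : G *m U *m V = G *m H - 1%:M.
  by rewrite mulmxDr mulmxV // mulmxA addrK.
suff: (1%:M + V *m G *m U) *m (1%:M - V *m invmx H *m U) = 1%:M.
  by case/mulmx1_unit.
rewrite mulmxBr mulmx1 mulmxDl mul1mx.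
have -> : V *m G *m U *m (V *m invmx H *m U) = V *m (G *m U *m V *m invmx H) *m U.
  by rewrite !mulmxA.
by rewrite GUV mulmxBl -(mulmxA G) mulmxV // mulmx1 mul1mx mulmxBr mulmxBl
  [V *m invmx H *m U + _]addrC subrK addrK.
Qed.

Lemma woodbury (R : comUnitRingType) (n d : nat)
    (G : 'M[R]_n) (U : 'M[R]_(n, d)) (V : 'M[R]_(d, n)) :
  G \in unitmx -> U *m V + invmx G \in unitmx ->
  invmx (U *m V + invmx G) =
    G - G *m U *m invmx (1%:M + V *m G *m U) *m V *m G.
Proof.
move=> uG uH; have := woodbury_capacitance_unitmx uG uH.
set K := 1%:M + _ => uK; set H := U *m V + invmx G in uH *.
(* Pushing H through G *m U leaves U followed by K. *)
have HGU : H *m G *m U = U *m K.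
  by rewrite !mulmxDl mulVmx // mul1mx mulmxDr mulmx1 addrC !mulmxA.
apply: (can_inj (mulKmx uH)); rewrite mulmxV // mulmxBr !mulmxA HGU.
by rewrite mulmxK // mulmxDl mulVmx // addrAC subrr add0r.
Qed.

Lemma mdotDr (R : realType) (n : nat) (M : 'M[R]_n) (u v v' : 'cV[R]_n) :
  mdot M u (v + v') = mdot M u v + mdot M u v'.
Proof. by rewrite /mdot mulmxDr mxE. Qed.

Lemma mdotZr (R : realType) (n : nat) (M : 'M[R]_n) (c : R)
    (u v : 'cV[R]_n) :
  mdot M u (c *: v) = c * mdot M u v.
Proof. by rewrite /mdot -scalemxAr mxE. Qed.

Lemma mdotC (R : realType) (n : nat) (M : 'M[R]_n) (u v : 'cV[R]_n) :
  M^T = M -> mdot M u v = mdot M v u.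
Proof.
move=> symM; rewrite /mdot.
have -> : v^T *m M *m u = (u^T *m M *m v)^T.
  by rewrite !trmx_mul trmxK symM mulmxA.
by rewrite [RHS]mxE.
Qed.

Lemma mdot_madjointr (R : realType) (n d : nat) (M : 'M[R]_n)
    (F : 'M[R]_(d, n)) (u : 'cV[R]_n) (x : 'cV[R]_d) :
  M \in unitmx ->
  mdot M u (madjoint M F *m x) = ((F *m u)^T *m x) ord0 ord0.
Proof. by move=> uM; rewrite /mdot /madjoint !mulmxA mulmxK // trmx_mul. Qed.

(** A vector in the kernel of [M *m A] would have <u, A u>_M = 0. *)
Lemma mposdef_unitmx (R : realType) (n : nat) (M A : 'M[R]_n) :
  mposdef M A -> M \in unitmx /\ A \in unitmx.
Proof.
move=> posA; apply/andP; rewrite -unitmx_mul -row_free_unit.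
apply: inj_row_free => v vMA0; apply/eqP; apply: contraT => v_neq0.
have /posA : v^T != 0 by rewrite trmx_eq0.
by rewrite /mdot trmxK !mulmxA -(mulmxA v) vMA0 mul0mx mxE ltxx.
Qed.

(** Substituting u = A v turns <u, A^-1 u>_M into <A v, v>_M. *)
Lemma mposdef_invmx (R : realType) (n : nat) (M A : 'M[R]_n) :
  M^T = M -> mposdef M A -> mposdef M (invmx A).
Proof.
move=> symM posA u u_neq0; have [_ uA] := mposdef_unitmx posA.
rewrite -[X in mdot M X](mulKVmx uA) mdotC //; apply: posA.
by apply: contra_neq u_neq0 => v0; rewrite -(mulKVmx uA u) v0 mulmx0.
Qed.

Lemma weightmxE (R : realType) (r s : nat) (w : 'rV[R]_s) :
  weightmx r w = diag_mx (\row_k w ord0 (mxtens_unindex k).2).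
Proof.
apply/matrixP => k l; case: (mxtens_indexP k) => k1 k2.
case: (mxtens_indexP l) => l1 l2; rewrite tensmxE !mxE mxtens_indexK.
rewrite (can_eq (@mxtens_indexK r s)) xpair_eqE /=.
by case: (k1 == l1); rewrite ?mul1r ?mul0r.
Qed.

Lemma weightmx_ge0 (R : realType) (r s : nat) (w : 'rV[R]_s)
    (x : 'cV[R]_(r * s)) :
  (forall i, 0 <= w ord0 i) -> 0 <= (x^T *m weightmx r w *m x) ord0 ord0.
Proof.
move=> w_ge0; rewrite weightmxE mul_mx_diag mxE sumr_ge0 // => k _.
by rewrite !mxE mulrAC mulr_ge0 // -expr2 sqr_ge0.
Qed.

Lemma mposdef_precision (R : realType) (n s r : nat) (c : R)
    (M G : 'M[R]_n) (F : 'M[R]_(r * s, n)) (w : 'rV[R]_s) :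
  0 <= c -> M^T = M -> mposdef M G -> (forall i, 0 <= w ord0 i) ->
  mposdef M (c *: (madjoint M F *m weightmx r w *m F) + invmx G).
Proof.
move=> c_ge0 symM posG w_ge0 u u_neq0; have [uM _] := mposdef_unitmx posG.
rewrite mulmxDl mdotDr ltr_wpDl //; last exact: mposdef_invmx.
rewrite -scalemxAl mdotZr mulr_ge0 //.
rewrite -(mulmxA _ F) -(mulmxA _ _ (F *m u)) mdot_madjointr // mulmxA.
exact: weightmx_ge0.
Qed.

Theorem proposition1 (R : realType) (n s r : nat)
    (n_ge1 : (1 <= n)%N) (s_ge1 : (1 <= s)%N) (r_ge1 : (1 <= r)%N)
    (sigma : R) (sigma_gt0 : 0 < sigma)
    (M : 'M[R]_n) (M_spd : sym_posdef M)
    (Gpr : 'M[R]_n) (Gpr_sa : mselfadjoint M Gpr) (Gpr_pd : mposdef M Gpr)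
    (F : 'M[R]_(r * s, n))
    (w : 'rV[R]_s) (w01 : forall i : 'I_s, 0 <= w ord0 i <= 1) :
  let Fs := madjoint M F in
  let W := weightmx r w in
  let H := sigma ^- 2 *: (Fs *m W *m F) + invmx Gpr in
  let K := 1%:M + sigma ^- 2 *: (W *m F *m Gpr *m Fs) in
  [/\ M \in unitmx, Gpr \in unitmx, H \in unitmx, K \in unitmx
    & invmx H =
      Gpr - sigma ^- 2 *: (Gpr *m Fs *m invmx K *m W *m F *m Gpr)].
Proof.
move=> Fs W H K; have [uM uG] := mposdef_unitmx Gpr_pd.
have [_ uH] : M \in unitmx /\ H \in unitmx.
  apply/mposdef_unitmx/mposdef_precision => //.
  - by rewrite invr_ge0 exprn_ge0 // ltW.
  - by case: M_spd.
  - by move=> i; case/andP: (w01 i).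
have HE : H = (sigma ^- 2 *: Fs) *m (W *m F) + invmx Gpr.
  by rewrite /H -scalemxAl mulmxA.
have KE : K = 1%:M + (W *m F) *m Gpr *m (sigma ^- 2 *: Fs).
  by rewrite /K -scalemxAr.
rewrite HE in uH *; split=> //.
  by rewrite KE; apply: woodbury_capacitance_unitmx.
by rewrite woodbury // -KE -scalemxAr -!scalemxAl !mulmxA.
Qed.
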